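(* Let $G$ be an extraspecial $2$-group of order $2^{2m+1}$ ($m\geqslant 1$) and let $H\leqslant G$. Then $H$ is a perfect code of $G$ if and only if one of the following holds: $H$ is non-abelian; or $H$ is abelian and $H$ is not normal in $G$; or $H$ is a maximal abelian subgroup of $G$ and $G\cong G_{m,1}$.
   Context: All groups are finite; all graphs are finite, undirected and simple. For a group $G$ and an inverse-closed subset $S\subseteq G\setminus\{1\}$, the Cayley graph $\mathrm{Cay}(G,S)$ has vertex set $G$, with $x,y\in G$ adjacent if and only if $yx^{-1}\in S$. A subset $C$ of the vertex set of a graph $\Gamma$ is a perfect code in $\Gamma$ if $C$ is an independent set and every vertex of $\Gamma$ is at distance at most $1$ from exactly one vertex of $C$. A subgroup $H$ of a group $G$ is called a perfect code of $G$ if there exists a Cayley graph $\mathrm{Cay}(G,S)$ of $G$ in which $H$ is a perfect code. A finite $2$-group $G$ is extraspecial if its center $Z(G)$ has order $2$ and $G/Z(G)$ is a (nontrivial) elementary abelian $2$-group; then $|G|=2^{2m+1}$ for some positive integer $m$. For a positive integer $m$, $G_{m,1}$ denotes the central product $D_8\circ\cdots\circ D_8$ of $m$ copies of the dihedral group $D_8$ of order $8$, with all the centers (of order $2$) identified; it is extraspecial of order $2^{2m+1}$. A maximal abelian subgroup of $G$ is an abelian subgroup not properly contained in any other abelian subgroup of $G$.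
   Formalization: H is assumed nontrivial: for H = 1 the claim fails for every G, since {1} is a perfect code in Cay(G, G∖{1}), yet H = 1 is abelian, normal and properly contained in the abelian subgroup Z(G). *)

(* Defs.v *)
From mathcomp Require Import all_boot all_fingroup all_solvable.

Set Implicit Arguments.
Unset Strict Implicit.
Unset Printing Implicit Defensive.

Local Open Scope group_scope.

(* A graph is given by a vertex set V inside an ambient finite type T and an
   adjacency relation e on T. *)
Section PerfectCode.

Variable T : finType.
Implicit Types (e : rel T) (V C : {set T}).

(* Distance at most n, as a walk with at most n edges. *)
Definition dist_le e (n : nat) (x y : T) : Prop :=
  exists p : seq T, [/\ size p <= n, path e x p & last x p = y].

Definition independent e C : Prop := {in C &, forall x y, ~~ e x y}.

Definition perfect_code V e C : Prop :=
  [/\ C \subset V, independent e C &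
      forall x, x \in V -> exists! c, c \in C /\ dist_le e 1 x c].

End PerfectCode.

Section CayleyGraph.

Variable gT : finGroupType.
Implicit Types (G H : {group gT}) (S : {set gT}).

Definition connection_set G S : Prop :=
  S \subset G^# /\ {in S, forall x, x^-1 \in S}.

Definition cayley G S : rel gT :=
  fun x y => [&& x \in G, y \in G & y * x^-1 \in S].

Definition perfect_code_of G H : Prop :=
  exists S : {set gT}, connection_set G S /\ perfect_code G (cayley G S) H.

Lemma trivial_perfect_code G : perfect_code_of G 1%G.
Proof.
exists G^#; split; first split=> //.
  by move=> x; rewrite !inE invg_eq1 groupV.
split; first exact: sub1G.
  move=> x y /set1P-> /set1P->; rewrite /cayley !inE mulgV eqxx /=.
  by rewrite !andbF.
move=> x Gx; exists 1; split; last by move=> y [/set1P->].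
split; first exact: group1.
have [->|x1] := eqVneq x 1; first by exists [::].
exists [:: 1]; split=> //=; by rewrite /cayley Gx group1 !inE mul1g invg_eq1 x1 groupV Gx.
Qed.

(* For 2-groups, [extraspecial] (Phi(G) = G' = Z(G) of prime order) amounts to
   Z(G) having order 2 and G / Z(G) being nontrivial elementary abelian. *)
Lemma extraspecial2P G : 2.-group G ->
  extraspecial G <->
  [/\ #|'Z(G)| = 2, 2.-abelem (G / 'Z(G)) & G / 'Z(G) != 1].
Proof.
move=> pG; split=> [esG | [oZ abelGZ ntGZ]].
  have [[defPhi defG'] _] := esG; split.
  - exact: card_center_extraspecial pG esG.
  - by rewrite -defPhi Phi_quotient_abelem.
  apply: contraNneq (extraspecial_nonabelian esG) => GZ1.
  by apply: cyclic_center_factor_abelian; rewrite GZ1 cyclic1.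
have prZ : prime #|'Z(G)| by rewrite oZ.
have nZG := normal_norm (center_normal G).
have sPZ : 'Phi(G) \subset 'Z(G) by rewrite (Phi_min pG).
have sDP : G^`(1) \subset 'Phi(G) by rewrite (Phi_joing pG) joing_subl.
have ntD : G^`(1) != 1.
  apply: contraNneq ntGZ => /derG1P cGG.
  by rewrite (center_idP cGG) trivg_quotient.
have defD : G^`(1) = 'Z(G).
  apply/eqP; rewrite eqEsubset (subset_trans sDP sPZ) /=.
  have := prime_TIg prZ.
  move/(_ G^`(1)%G); case: (boolP ('Z(G) \subset G^`(1))) => // nsZD /(_ isT).
  by rewrite (setIidPr (subset_trans sDP sPZ)) => D1; rewrite D1 eqxx in ntD.
split=> //; split=> //.
by apply/eqP; rewrite eqEsubset sPZ -{1}defD.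
Qed.

End CayleyGraph.

(* Main.v *)
Require Import Defs.
From mathcomp Require Import all_boot all_fingroup all_solvable.

(* A perfect code H is the same as an inverse-closed right transversal of H
   containing 1, so a normal perfect code needs an involution (or 1) in every
   coset whose square is trivial in G / H.  If H misses Z = Z(G), any
   transversal of HZ multiplied by Z works, since squares lie in Z.
   Otherwise, identify Z with F_2, so that squaring is a quadratic form on G / Z
   with polar form the commutator.  A coset Hx without involutions forces
   h^2 = [h, x] on H, so that squaring is linear on H and H is abelian.  If H is
   abelian, then h^2 = [h, g] on H for some g, and every coset of H has an
   involution iff (gc)^2 = 1 for all c in C_G(H).  This makes C_G(H) abelian,
   hence equal to H, and then g and the elements of H of square 1 generate an
   elementary abelian subgroup of order 2^(m+1), which exists only in the
   central power of D_8; conversely, when there is such a subgroup E, g^2 != 1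
   is excluded by comparing E with the elements of H of square 1. *)

Local Open Scope group_scope.

(** * Perfect codes as inverse-closed transversals *)

Section PerfectCodes.

Variable gT : finGroupType.
Implicit Types (G H K : {group gT}) (T : {set gT}).

Lemma dist_le1P (e : rel gT) x y :
  reflect (dist_le e 1 x y) ((y == x) || e x y).
Proof.
apply: (iffP orP) => [[/eqP-> | exy]|[[|u [|v p]] []]] //=.
- by exists [::].
- by exists [:: y]; rewrite /= exy.
- by move=> _ _ ->; left.
- by rewrite andbT => _ exu <-; right.
Qed.

(** With [T] minus 1 as connection set, the points of [H] within distance 1 of [x] are the [t * x]
    with [t] in [T] and in [H :* x^-1]. *)
Lemma perfect_code_of_transversal G H T :
    H \subset G -> T \subset G -> 1 \in T -> {in T, forall t, t^-1 \in T} ->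
    (forall x, x \in G -> exists! t, t \in T /\ t \in H :* x) ->
  perfect_code_of G H.
Proof.
move=> sHG sTG T1 TV trT; exists (T :\ 1); split; first split.
- by rewrite setSD.
- by move=> t /setD1P[t1 Tt]; rewrite !inE invg_eq1 t1 TV.
have edgeP x y : x \in G -> y \in G ->
    reflect (dist_le (cayley G (T :\ 1)) 1 x y) (y * x^-1 \in T).
  move=> Gx Gy; suff ->: (y * x^-1 \in T) = (y == x) || cayley G (T :\ 1) x y.
    exact: dist_le1P.
  rewrite /cayley Gx Gy !inE -eq_mulgV1 /=.
  by have [->|] := eqVneq y x; rewrite ?mulgV.
split=> // [x y Hx Hy | x Gx].
  apply/and3P=> [[_ _ /setD1P[ntyx Tyx]]].
  have [t [_ uniq_t]] := trT 1 (group1 G); case/eqP: ntyx.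
  by rewrite -(uniq_t (_ * _)) ?(uniq_t 1) // mulg1 ?groupM ?groupV.
have [t [[Tt /rcosetP[h Hh def_t]] uniq_t]] := trT x^-1 (groupVr Gx).
exists h; split=> [|k [Hk /(edgeP x k Gx (subsetP sHG k Hk)) Tk]].
  split=> //; apply/edgeP; rewrite -?def_t //; exact: (subsetP sHG).
apply: (mulIg x^-1); rewrite -def_t; apply: uniq_t.
by rewrite mem_rcoset mulgK.
Qed.

(* The representative of [H x] is unique and [H x] is closed under inversion,
   so the representative is its own inverse. *)
Lemma normal_perfect_code_involution G H x :
    H <| G -> perfect_code_of G H -> x \in G -> x ^+ 2 \in H ->
  exists2 h, h \in H & (h * x) ^+ 2 = 1.
Proof.
move=> /andP[sHG nHG] [S [[sSG SV] [_ _ codeH]]] Gx Hx2.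
have nHx := subsetP nHG x Gx.
have edgeP y : y \in G ->
    reflect (dist_le (cayley G S) 1 x^-1 y) ((y == x^-1) || (y * x \in S)).
  move=> Gy; suff ->: (y * x \in S) = cayley G S x^-1 y by apply: dist_le1P.
  by rewrite /cayley groupV Gx Gy invgK.
have [h [[Hh /(edgeP h (subsetP sHG h Hh)) Dh] uniq_h]] := codeH _ (groupVr Gx).
exists h => //; have Hk: (h * x)^-1 * x^-1 \in H.
  have ->: (h * x)^-1 * x^-1 = (h ^ x^-1 * x ^+ 2)^-1.
    by rewrite -invMg conjgE invgK expg2 !mulgA mulgKV.
  by rewrite groupV groupM ?memJ_norm ?groupV.
suff def_h: h = (h * x)^-1 * x^-1.
  by rewrite expgS expg1 {1}def_h mulgKV mulVg.
apply: uniq_h; split=> //; apply/edgeP; first exact: (subsetP sHG).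
rewrite mulgKV; case/orP: Dh => [/eqP->|/SV->]; last exact: orbT.
by rewrite mulVg invg1 mul1g eqxx.
Qed.

Lemma perfect_code_of_involutions G H :
    H \subset G ->
    (forall x, x \in G -> exists2 h, h \in H & (h * x) ^+ 2 = 1) ->
  perfect_code_of G H.
Proof.
move=> sHG invH.
(* Elements of square 1 are their own inverses. By [invH] the default 1 is never reached on a coset
   of an element of [G]. *)
pose f A := if A == H :> {set gT} then 1 else odflt 1 [pick y in A | y ^+ 2 == 1].
have fP x : x \in G -> f (H :* x) \in H :* x /\ f (H :* x) ^+ 2 = 1.
  move=> Gx; rewrite /f; case: eqP => [->|_]; first by rewrite group1 expg1n.
  case: pickP => [y /andP[Hxy /eqP]//|no_y].
  have [h Hh /eqP hx2] := invH x Gx.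
  by have:= no_y (h * x); rewrite mem_rcoset mulgK Hh hx2.
apply: (@perfect_code_of_transversal _ _ [set y in G | y == f (H :* y)]) => //.
- by apply/subsetP=> y /setIdP[].
- by rewrite inE group1 mulg1 /f eqxx /=.
- move=> y Ty; have:= Ty => /setIdP[Gy /eqP def_y].
  suff -> : y^-1 = y by [].
  by apply/eqP; rewrite eq_invg_mul -expg2 [y]def_y; case: (fP y Gy) => _ ->.
move=> x Gx; have [Hfx _] := fP x Gx; exists (f (H :* x)); split.
  rewrite inE (rcoset_eqP Hfx) eqxx andbT; split=> //.
  by apply: subsetP Hfx; rewrite mul_subG ?sub1set.
by move=> y [/setIdP[_ /eqP def_y] /rcoset_eqP <-].
Qed.

(* A transversal of [H K] translated by [K] is a transversal of [H], and it is
   inverse-closed because inversion preserves every coset of [K]. *)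
Lemma perfect_code_of_complement_squares G H K :
    H \subset G -> K <| G -> H :&: K = 1 ->
    (forall x, x \in G -> x ^+ 2 \in K) ->
  perfect_code_of G H.
Proof.
move=> sHG /andP[sKG nKG] tiHK sqK; have nKH := subset_trans sHG nKG.
pose f A := if A == H <*> K :> {set gT} then 1 else repr A.
have fP x : f ((H <*> K) :* x) \in (H <*> K) :* x.
  by rewrite /f; case: eqP => [->|_]; rewrite ?group1 ?mem_repr_rcoset.
pose T := [set y in G | y * (f ((H <*> K) :* y))^-1 \in K].
have sKHK := joing_subr H K.
apply: (@perfect_code_of_transversal _ _ T) => //.
- by apply/subsetP=> y /setIdP[].
- by rewrite inE group1 mulg1 /f eqxx invg1 mulg1 /=.
- move=> y /setIdP[Gy Kyf]; have Ky2: y^-1 * y^-1 \in K.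
    by rewrite -invMg -expg2 groupV sqK.
  have ->: y^-1 = (y^-1 * y^-1) * y by rewrite mulgKV.
  rewrite inE groupM ?(subsetP sKG _ Ky2) //= rcosetM rcoset_id.
    by rewrite -mulgA groupM.
  exact: subsetP Ky2.
move=> x Gx; have:= fP x; set fx := f _; rewrite mem_rcoset norm_joinEl //.
case/mulsgP=> h k Hh Kk def_fx.
have HKhx h' : h' \in H -> (H <*> K) :* (h' * x) = (H <*> K) :* x.
  move=> Hh'; apply/rcoset_eqP; rewrite mem_rcoset mulgK.
  exact: (subsetP (joing_subl H K)).
(* As [fx = h * k * x], an element [h' * x] of [T] has [h' * h^-1] in [H :&: K], so [h' = h]. *)
have Tfx h' : h' \in H -> h' * x \in T = (h' * h^-1 \in K).
  move=> Hh'; rewrite inE HKhx // groupMr // (subsetP sHG) //= -/fx.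
  rewrite -[fx](mulgKV x) def_fx !invMg !mulgA mulgK.
  have ->: h' * k^-1 * h^-1 = (h' * h^-1) * k^-1 ^ h^-1.
    by rewrite conjgE invgK !mulgA mulgKV.
  by apply: groupMr; rewrite memJ_norm ?groupV ?(subsetP nKH) ?groupV.
exists (h * x); split=> [|y [Ty /rcosetP[h' Hh' def_y]]].
  by rewrite Tfx // mulgV group1 mem_rcoset mulgK.
move: Ty; rewrite {y}def_y Tfx // => Kh; congr (_ * x); apply/esym/eqP.
by rewrite eq_mulgV1; apply/eqP/set1gP; rewrite -tiHK inE Kh groupM ?groupV.
Qed.
End PerfectCodes.

(** * Central powers of the dihedral group and the 2-rank *)

(** All automorphisms of the centre extend to [B], so a central product with [B] does not depend on
    how the centres are identified. *)
Lemma isog_ncprod (aT bT : finGroupType) (A : {group aT}) (B : {group bT}) n :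
    Aut_in (Aut B) 'Z(B) \isog Aut 'Z(B) -> A \isog B ->
  [set: ncprod A n] \isog [set: ncprod B n].
Proof.
move=> AutB isoAB; elim: n => [|n IHn].
  rewrite (isog_transl _ (ncprod0 A)) isog_sym (isog_transl _ (ncprod0 B)).
  by rewrite isog_sym gFisog.
have -> : ncprod B n.+1 = xcprod B [set: ncprod B n].
  by rewrite [@ncprod _ B]unlock.
case: (ncprodS A n) => gz isoZ; apply: isog_xcprod (im_cpair_cprod isoZ) _ => //.
- by apply: isog_trans isoAB; rewrite isog_sym sub_isog ?injm_cpairg1.
- by apply: isog_trans IHn; rewrite isog_sym sub_isog ?injm_cpair1g.
exact: cpair_center_id.
Qed.

(** For positive [m] there are two candidates for [G]: the central power of ['D_8], of 2-rank
    [m + 1], and its variant with one quaternion factor, of 2-rank [m]. *)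
Lemma isog_Dn_p_rank (gT : finGroupType) (G : {group gT}) m :
    extraspecial G -> #|G| = (2 ^ m.*2.+1)%N ->
  (G \isog [set: ncprod 'D_8 m]) = (m < 'r_2(G)).
Proof.
move=> esG oG.
have isoDm: 'D^m \isog [set: ncprod 'D_8 m].
  apply: isog_ncprod isog_2X1p2; apply: (@Aut_extraspecial_full 2).
    by rewrite /pgroup -(card_isog isog_2X1p2) card_pX1p2.
  by apply: isog_extraspecial isog_2X1p2 _; exact: pX1p2_extraspecial.
apply/idP/idP=> [isoG | rG].
  by rewrite (isog_p_rank isoG) -(isog_p_rank isoDm) rank_Dn.
have [isoG | isoG] := isog_2extraspecial oG esG; first exact: isog_trans isoDm.
case: m => [|m] in oG rG isoG isoDm *; last first.
  by rewrite (isog_p_rank isoG) rank_DnQ ltnn in rG.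
case/negP: (extraspecial_nonabelian esG).
by rewrite cyclic_abelian // prime_cyclic // oG.
Qed.

(** * Squares and commutators in an extraspecial 2-group *)

Section Extraspecial2.

Set Implicit Arguments.
Unset Strict Implicit.

Variables (gT : finGroupType) (G : {group gT}).
Hypotheses (pG : 2.-group G) (esG : extraspecial G).
Implicit Types H A : {group gT}.

Let oZ : #|'Z(G)| = 2 := card_center_extraspecial pG esG.

Lemma square_extraspecial2 x : x \in G -> x ^+ 2 \in 'Z(G).
Proof.
move=> Gx; have [[<- _] _] := esG; rewrite (Phi_joing pG).
by rewrite mem_gen // inE (Mho_p_elt 1 Gx (mem_p_elt pG Gx)) orbT.
Qed.

Let sqZ := square_extraspecial2.

Let commZ x y : x \in G -> y \in G -> [~ x, y] \in 'Z(G).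
Proof. by have [[_ <-] _] := esG; apply: mem_commg. Qed.

Let centZ u x : u \in 'Z(G) -> x \in G -> commute u x.
Proof. by move=> /centerP[_ cGu] /cGu. Qed.

Let mulZZ u : u \in 'Z(G) -> u * u = 1.
Proof. by rewrite -expg2 -oZ => /expg_cardG. Qed.

Let eqZ u v : u \in 'Z(G) -> v \in 'Z(G) -> u != 1 -> v != 1 -> u = v.
Proof.
move=> Zu Zv nt_u nt_v; apply/eqP; apply: contraTT (leqnn #|'Z(G)|) => neq_uv.
rewrite [X in _ <= X]oZ -ltnNge; have: [set 1; u; v] \subset 'Z(G).
  by rewrite !subUset !sub1set group1 Zu Zv.
move/subset_leq_card; apply: leq_trans.
by rewrite -setUA cardsU1 cards2 !inE neq_uv ![1 == _]eq_sym negb_or nt_u nt_v.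
Qed.

Let commMl x y w : x \in G -> y \in G -> w \in G ->
  [~ x * y, w] = [~ x, w] * [~ y, w].
Proof.
move=> Gx Gy Gw; rewrite commMgJ /conjg [_ * y](centZ (commZ Gx Gw) Gy).
by rewrite mulKg.
Qed.

Let commC x y : x \in G -> y \in G -> [~ x, y] = [~ y, x].
Proof.
by move=> Gx Gy; rewrite -invg_comm; apply/eqP; rewrite eq_invg_mul mulZZ ?commZ.
Qed.

Let commMr x y w : x \in G -> y \in G -> w \in G ->
  [~ w, x * y] = [~ w, x] * [~ w, y].
Proof.
by move=> Gx Gy Gw; rewrite commC ?groupM // commMl // !(@commC w).
Qed.

Let sqM x y : x \in G -> y \in G ->
  (x * y) ^+ 2 = x ^+ 2 * y ^+ 2 * [~ x, y].
Proof.
move=> Gx Gy; rewrite expMg_Rmul 1?commC //;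
  by apply/commute_sym/centZ; rewrite ?commZ.
Qed.

(** Commutation with [g] is multiplicative, while squaring is so only up to [[~ h, k]], which is
    therefore trivial. *)
Lemma square_commutator_abelian H g :
    H \subset G -> g \in G -> {in H, forall h, h ^+ 2 = [~ h, g]} ->
  abelian H.
Proof.
move=> /subsetP sHG Gg sqH; apply/centsP=> h Hh k Hk; apply/commgP/eqP.
have [Gh Gk] := (sHG h Hh, sHG k Hk).
have:= sqH _ (groupM Hh Hk); rewrite sqM // commMl // !sqH //.
by move/(canRL (mulKg _)); rewrite mulVg.
Qed.

(** Both [(h * x) ^+ 2] and [x ^+ 2] are the one nontrivial central element, so the factors [h ^+ 2]
    and [[~ h, x]] cancel. *)
Lemma no_involution_coset H x :
    H \subset G -> x \in G -> {in H, forall h, (h * x) ^+ 2 != 1} ->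
  x ^+ 2 != 1 /\ {in H, forall h, h ^+ 2 = [~ h, x]}.
Proof.
move=> sHG Gx ntHx; have ntx: x ^+ 2 != 1 by rewrite -[x]mul1g ntHx.
split=> // h Hh; have Gh := subsetP sHG h Hh.
have:= eqZ (sqZ (groupM Gh Gx)) (sqZ Gx) (ntHx h Hh) ntx.
rewrite sqM // (centZ (sqZ Gh) (groupX 2 Gx)) -mulgA => /(canRL (mulKg _)).
rewrite mulVg => /(canRL (mulgK _)); rewrite mul1g => ->.
by apply/eqP; rewrite eq_invg_mul mulZZ ?commZ.
Qed.

Lemma nonabelian_involution_coset H x :
    H \subset G -> ~~ abelian H -> x \in G ->
  exists2 h, h \in H & (h * x) ^+ 2 = 1.
Proof.
move=> sHG not_cHH Gx.
have [/exists_inP[h Hh /eqP hx2]|] := boolP [exists h in H, (h * x) ^+ 2 == 1].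
  by exists h.
rewrite negb_exists_in => /forall_inP/(no_involution_coset sHG Gx)[_ sqH].
by rewrite (square_commutator_abelian sHG Gx sqH) in not_cHH.
Qed.

(** * Orders of centralizers and the kernel of squaring *)

(** Nondegeneracy of the commutator pairing, in counting form. *)
Lemma card_subcent_mul H :
  'Z(G) \subset H -> H \subset G -> (#|'C_G(H)| * #|H| = 2 * #|G|)%N.
Proof.
move=> sZH sHG; rewrite (card_subcent_extraspecial pG) // (setIidPl sZH) oZ.
by rewrite -mulnA [(_ * #|H|)%N]mulnC Lagrange.
Qed.

Lemma mem_Ohm1_abelian H h :
  H \subset G -> abelian H -> (h \in 'Ohm_1(H)) = (h \in H) && (h ^+ 2 == 1).
Proof.
move=> sHG cHH; rewrite (OhmEabelian (pgroupS sHG pG)) ?inE //.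
exact: abelianS (Ohm_sub 1 H) cHH.
Qed.

Lemma center_sub_Ohm1 H :
  H \subset G -> abelian H -> 'Z(G) \subset H -> 'Z(G) \subset 'Ohm_1(H).
Proof.
move=> sHG cHH sZH; apply/subsetP=> u Zu.
by rewrite mem_Ohm1_abelian // (subsetP sZH) //= expg2 mulZZ.
Qed.

(* All elements of [H] outside [K := 'Ohm_1(H)] lie in one coset of [K]. *)
Lemma abelian_square_Ohm1 H h k :
    H \subset G -> abelian H -> h \in H :\: 'Ohm_1(H) -> k \in H :\: 'Ohm_1(H) ->
  h * k \in 'Ohm_1(H).
Proof.
move=> sHG cHH; rewrite !inE !mem_Ohm1_abelian //.
case/andP=> + Hh /andP[+ Hk]; rewrite Hh Hk groupM //= => nth ntk.
have [Gh Gk] := (subsetP sHG h Hh, subsetP sHG k Hk).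
rewrite sqM // (eqZ (sqZ Gh) (sqZ Gk)) // mulZZ ?sqZ // mul1g.
by apply/commgP/(centsP cHH).
Qed.

Lemma card_abelian_Ohm1 H :
  H \subset G -> abelian H -> #|H| <= 2 * #|'Ohm_1(H)|.
Proof.
move=> sHG cHH; set K := 'Ohm_1(H).
have [sHK | /subsetPn[h Hh notKh]] := boolP (H \subset K).
  by rewrite (leq_trans (subset_leq_card sHK)) // leq_pmull.
have sHKK: H \subset K :|: K :* h^-1.
  apply/subsetP=> k Hk; rewrite !inE mem_rcoset invgK.
  have [//|notKk] := boolP (k \in K).
  by rewrite abelian_square_Ohm1 // inE ?notKk ?notKh.
apply: leq_trans (subset_leq_card sHKK) _.
apply: leq_trans (leq_card_setU _ _) _.
by rewrite card_rcoset addnn mul2n.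
Qed.

(** Squaring and commutation with [g] both map [H] to a group of order 2 and kill ['Ohm_1(H)], of
    index at most 2; off it, both are nontrivial. *)
Lemma Ohm1_cent_square H g :
    H \subset G -> abelian H -> g \in 'C_G('Ohm_1(H)) -> g \notin 'C(H) ->
  {in H, forall h, h ^+ 2 = [~ h, g]}.
Proof.
move=> sHG cHH /setIP[Gg cKg] not_cHg h Hh; have Gh := subsetP sHG h Hh.
have [Kh | notKh] := boolP (h \in 'Ohm_1(H)).
  have:= Kh; rewrite mem_Ohm1_abelian // => /andP[_ /eqP->].
  by apply/esym/eqP/commgP/commute_sym/(centP cKg).
apply: eqZ; rewrite ?sqZ ?commZ //.
  by apply: contra notKh => h2; rewrite mem_Ohm1_abelian ?Hh.
(* Commuting with one [h] outside ['Ohm_1(H)] would make [g] centralize [H]. *)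
apply: contra not_cHg => /commgP chg; apply/centP=> k Hk.
have [/(centP cKg)// | notKk] := boolP (k \in 'Ohm_1(H)).
apply: commute_sym; rewrite -[k](mulgK h); apply/commute_sym/commuteM.
  by apply: (centP cKg); rewrite abelian_square_Ohm1 // inE ?notKk ?notKh.
exact/commuteV/commute_sym.
Qed.

(* Squaring is a homomorphism from [H] to ['Z(G)]; nondegeneracy of the
   commutator pairing represents it by some [g]. *)
Lemma abelian_square_commutator H :
    H \subset G -> abelian H -> 'Z(G) \subset H ->
  exists2 g, g \in G & {in H, forall h, h ^+ 2 = [~ h, g]}.
Proof.
move=> sHG cHH sZH; have sKH := Ohm_sub 1 H; have sKG := subset_trans sKH sHG.
have [sHK | not_sHK] := boolP (H \subset 'Ohm_1(H)).
  exists 1 => // h /(subsetP sHK); rewrite commg1 mem_Ohm1_abelian //.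
  by case/andP=> _ /eqP.
(* Equal centralizers would force [H] and ['Ohm_1(H)] to have equal orders. *)
have [|g Cg notCg] := subsetPn (_ : ~~ ('C_G('Ohm_1(H)) \subset 'C_G(H))).
  apply: contra not_sHK => /subset_leq_card leC.
  rewrite -(geq_leqif (subset_leqif_card sKH)).
  have sZK := center_sub_Ohm1 sHG cHH sZH.
  rewrite -(leq_pmul2l (cardG_gt0 'C_G(H))) (card_subcent_mul sZH sHG).
  by rewrite -(card_subcent_mul sZK sKG) leq_pmul2r.
have [Gg _] := setIP Cg; exists g => //; apply: Ohm1_cent_square => //.
by move: notCg; rewrite inE Gg.
Qed.

(** * Involutions in the cosets of an abelian subgroup *)

(** If [H :* x] has no element of square 1, then [x] and [g] have the same commutators with [H], so
    [g * x] centralizes [H]. Conversely, all elements of [H :* (g * c)] have the same square. *)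
Lemma abelian_involution_cosetP H g :
    H \subset G -> abelian H -> 'Z(G) \subset H -> g \in G ->
    {in H, forall h, h ^+ 2 = [~ h, g]} ->
  (forall x, x \in G -> exists2 h, h \in H & (h * x) ^+ 2 = 1) <->
  {in 'C_G(H), forall c, (g * c) ^+ 2 = 1}.
Proof.
move=> sHG cHH sZH Gg sqH; split=> [invH c /setIP[Gc cHc] | sq1 x Gx].
  have [h Hh] := invH _ (groupM Gg Gc); have Gh := subsetP sHG h Hh.
  rewrite sqM ?groupM // commMr // -sqH //.
  have /commgP/eqP->: commute h c by apply/commute_sym/(centP cHc).
  rewrite mulg1 -mulgA -(centZ (sqZ Gh)) ?groupX ?groupM // mulgA.
  by rewrite mulZZ ?sqZ // mul1g.
have [/exists_inP[h Hh /eqP hx2]|] := boolP [exists h in H, (h * x) ^+ 2 == 1].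
  by exists h.
rewrite negb_exists_in => /forall_inP/(no_involution_coset sHG Gx)[ntx sqHx].
have Cgx: g * x \in 'C_G(H).
  rewrite inE groupM //=; apply/centP=> h Hh; have Gh := subsetP sHG h Hh.
  by apply/commute_sym/commgP; rewrite commMr // -sqH // -sqHx // mulZZ ?sqZ.
have /commgP/eqP cg2x: commute (g ^+ 2) x by apply: centZ (sqZ Gg) Gx.
case/eqP: ntx; have:= sq1 _ Cgx; rewrite mulgA -expg2 sqM ?groupX // cg2x.
by rewrite [(_ ^+ 2) ^+ 2]expg2 mulZZ ?sqZ // mul1g mulg1.
Qed.

Lemma maximal_abelian_subcent H :
  [max H | H \subset G & abelian H] -> 'C_G(H) = H.
Proof.
case/maxgroupP=> /andP[sHG cHH] maxH; apply/eqP; rewrite eqEsubset andbC.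
rewrite subsetI sHG [H \subset _]cHH; apply/subsetP=> x /setIP[Gx cHx].
rewrite -cycle_subG -(maxH (<[x]> <*> H)%G) ?joing_subl ?joing_subr //.
by rewrite join_subG cycle_subG Gx sHG abelianY cycle_abelian cHH centsC
  cycle_subG.
Qed.

(** Taking [c = 1] gives [g ^+ 2 = 1]; then [c ^+ 2 = [~ c, g]] on ['C_G(H)], which is thus abelian,
    and the order formula bounds it by [H]. *)
Lemma involution_coset_subcent H g :
    H \subset G -> abelian H -> 'Z(G) \subset H -> g \in G ->
    {in H, forall h, h ^+ 2 = [~ h, g]} ->
    (forall x, x \in G -> exists2 h, h \in H & (h * x) ^+ 2 = 1) ->
  g ^+ 2 = 1 /\ 'C_G(H) = H.
Proof.
move=> sHG cHH sZH Gg sqH /(abelian_involution_cosetP sHG cHH sZH Gg sqH) sq1.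
have g2: g ^+ 2 = 1 by rewrite -[g]mulg1 sq1.
have sHC: H \subset 'C_G(H) by rewrite subsetI sHG.
have cCC: abelian 'C_G(H).
  apply: (square_commutator_abelian (subsetIl _ _) Gg) => c Cc.
  have [Gc _] := setIP Cc; have:= sq1 c Cc; rewrite sqM // g2 mul1g commC //.
  move/(canRL (mulgK _)) ->; rewrite mul1g; apply/eqP.
  by rewrite eq_invg_mul mulZZ ?commZ.
split=> //; apply/eqP; rewrite eq_sym eqEcard sHC /=.
have sZC := subset_trans sZH sHC.
rewrite -(leq_pmul2l (cardG_gt0 'C_G(H))) (card_subcent_mul sZH sHG).
rewrite -(card_subcent_mul sZC (subsetIl _ _)) leq_pmul2r //.
by rewrite subset_leq_card // subsetI subsetIl.
Qed.

Lemma card_self_subcent H m :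
    #|G| = (2 ^ m.*2.+1)%N -> 'Z(G) \subset H -> 'C_G(H) = H ->
  #|H| = (2 ^ m.+1)%N.
Proof.
move=> oG sZH defC; have sHG: H \subset G by rewrite -defC subsetIl.
have:= card_subcent_mul sZH sHG; rewrite defC oG -expnS -doubleS.
by rewrite -muln2 expnM mulnn => /eqP; rewrite eqn_sqr => /eqP.
Qed.

Lemma involution_cosets_rank H m :
    #|G| = (2 ^ m.*2.+1)%N ->
    H \subset G -> abelian H -> 'Z(G) \subset H ->
    (forall x, x \in G -> exists2 h, h \in H & (h * x) ^+ 2 = 1) ->
  [max H | H \subset G & abelian H] /\ m < 'r_2(G).
Proof.
move=> oG sHG cHH sZH invH.
have [g Gg sqH] := abelian_square_commutator sHG cHH sZH.
have [g2 defC] := involution_coset_subcent sHG cHH sZH Gg sqH invH.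
have oH := card_self_subcent oG sZH defC; split.
  apply/maxgroupP; rewrite sHG; split=> // A /andP[sAG cAA] sHA.
  by apply/eqP; rewrite eqEsubset sHA andbT -defC subsetI sAG (centsS sHA).
pose K := 'Ohm_1(H)%G; have sKH: K \subset H := Ohm_sub 1 H.
have sKG := subset_trans sKH sHG.
have cgK: <[g]> \subset 'C(K).
  rewrite cycle_subG; apply/centP=> k Kk; apply/commute_sym/commgP.
  rewrite -sqH ?(subsetP sKH) //.
  by have:= Kk; rewrite mem_Ohm1_abelian // => /andP[].
have abelK: 2.-abelem K by rewrite Ohm1_abelem ?(pgroupS sHG).
have abelg: 2.-abelem <[g]>.
  apply/abelemP=> //; split=> [|_ /cycleP[i ->]]; first exact: cycle_abelian.
  by rewrite expgAC g2 expg1n.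
pose E := (K <*> <[g]>)%G.
have abelE: 2.-abelem E.
  by rewrite /E /= (cprod_abelem _ (cprodEY cgK)) abelK.
have sEG: E \subset G by rewrite join_subG sKG cycle_subG.
(* Either [g] is in [H] and squaring is trivial on [H], or adjoining [g] makes up for the index of
   [K], at most 2. *)
have leHE: #|H| <= #|E|.
  have [Hg | notHg] := boolP (g \in H).
    rewrite subset_leq_card //; apply: subset_trans (joing_subl _ _).
    apply/subsetP=> h Hh; rewrite mem_Ohm1_abelian // Hh sqH //=.
    by apply/commgP/(centsP cHH).
  apply: leq_trans (card_abelian_Ohm1 sHG cHH) _.
  rewrite -(Lagrange (joing_subl K <[g]>)) mulnC.
  rewrite leq_pmul2l // indexg_gt1 join_subG subxx cycle_subG.
  by apply: contra notHg; apply: subsetP.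
apply: leq_trans (p_rankS 2 sEG); rewrite (p_rank_abelem abelE).
by rewrite -(@leq_exp2l 2) // -oH -(card_pgroup (abelem_pgroup abelE)).
Qed.

Lemma rank_involution_cosets H m x :
    #|G| = (2 ^ m.*2.+1)%N -> [max H | H \subset G & abelian H] ->
    m < 'r_2(G) -> x \in G ->
  exists2 h, h \in H & (h * x) ^+ 2 = 1.
Proof.
move=> oG maxH rG Gx; have defC := maximal_abelian_subcent maxH.
have /andP[sHG cHH] := maxgroupp maxH.
have sZH: 'Z(G) \subset H by rewrite -[gval H]defC setIS ?centS.
have oH := card_self_subcent oG sZH defC.
have [g Gg sqH] := abelian_square_commutator sHG cHH sZH.
(* As ['C_G(H) = H], every [g * c] with [c] in [H] has square [g ^+ 2]. *)
suffices g2: g ^+ 2 = 1.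
  have [_] := abelian_involution_cosetP sHG cHH sZH Gg sqH; apply=> // c.
  rewrite defC => Hc; have Gc := subsetP sHG c Hc.
  by rewrite sqM // g2 mul1g commC // sqH // mulZZ ?commZ.
apply/eqP; apply: contraLR rG => ntg; rewrite -leqNgt.
have [E /pnElemP[sEG abelE <-]] := p_rank_witness 2 G.
have [cEE sqE] := abelemP (isT : prime 2) abelE.
rewrite leqNgt -(@leq_exp2l 2) // -oH -(card_pgroup (abelem_pgroup abelE)).
apply/negP=> leHE.
pose K := 'Ohm_1(H)%G; have sKH: K \subset H := Ohm_sub 1 H.
have sKG := subset_trans sKH sHG.
have sZK: 'Z(G) \subset K := center_sub_Ohm1 sHG cHH sZH.
have ltKH: #|K| < #|H|.
  rewrite proper_card // properE sKH; apply: contra ntg => /subsetP sHK.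
  suffices: g \in H by move/sHK; rewrite mem_Ohm1_abelian // => /andP[].
  rewrite -[gval H]defC inE Gg; apply/centP=> h Hh.
  apply/commute_sym/commgP; rewrite -sqH //.
  by have:= sHK h Hh; rewrite mem_Ohm1_abelian // => /andP[].
(* For [e] outside [H], commutation with [e] is also squaring on [H], so [g * e] is in [H];
   computing its square in two ways gives [g ^+ 2 = 1]. *)
have sCEK: E :&: 'C_G(K) \subset E :&: K.
  apply/subsetP=> e /setIP[Ee CKe]; have [Ge _] := setIP CKe.
  rewrite inE Ee mem_Ohm1_abelian // sqE // eqxx andbT.
  apply: contraR ntg => notHe.
  have cHe: e \notin 'C(H).
    by apply: contra notHe => ?; rewrite -[gval H]defC inE Ge.
  have sqeH := Ohm1_cent_square sHG cHH CKe cHe.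
  have Hge: g * e \in H.
    rewrite -[gval H]defC inE groupM //; apply/centP=> h Hh.
    have Gh := subsetP sHG h Hh; apply/commute_sym/commgP.
    by rewrite commMr // -sqH // -sqeH // mulZZ ?sqZ.
  have Gge := groupM Gg Ge; have := sqH _ Hge.
  rewrite commMl // commgg mul1g sqM // (sqE e Ee) mulg1 commC // => /eqP.
  by rewrite -[X in _ == X]mul1g (inj_eq (mulIg _)).
have oHH: (#|H| * #|H| = 2 * #|G|)%N.
  by rewrite -(card_subcent_mul sZH sHG) defC.
have leCE: #|'C_G(E)| * #|E| <= #|H| * #|H|.
  rewrite (card_subcent_extraspecial pG) // -mulnA [(_ * #|E|)%N]mulnC.
  by rewrite Lagrange // oHH leq_pmul2r // -oZ subset_leq_card ?subsetIl.
have sECE: E \subset 'C_G(E) by rewrite subsetI sEG.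
have leEH: #|E| <= #|H|.
  rewrite -leq_sqr -!mulnn (leq_trans _ leCE) // leq_pmul2r //.
  exact: subset_leq_card.
have sCEE: 'C_G(E) \subset E.
  rewrite -(geq_leqif (subset_leqif_card sECE)) -(leq_pmul2r (cardG_gt0 E)).
  by rewrite (leq_trans leCE) // leq_mul.
have nKE: E \subset 'N(K).
  apply: subset_trans sEG (sub_der1_norm _ sKG).
  by have [[_ ->] _] := esG.
have sUG: E <*> K \subset G by rewrite join_subG sEG.
have sZU: 'Z(G) \subset E <*> K := subset_trans sZK (joing_subr E K).
(* The order formula makes this product equal to [#|H| * #|H|], yet it is at most
   [#|E :&: K| * #|E <*> K| = #|E| * #|K|]. *)
suffices: #|'C_G(E <*> K)| * #|E <*> K| < #|H| * #|H|.
  by rewrite (card_subcent_mul sZU sUG) oHH ltnn.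
have sCU: 'C_G(E <*> K) \subset E :&: K.
  apply: subset_trans sCEK; rewrite subsetI setIS ?centS ?joing_subr //.
  by rewrite (subset_trans _ sCEE) // setIS ?centS ?joing_subl.
rewrite /= norm_joinEl // in sCU *.
apply: leq_ltn_trans (leq_mul (subset_leq_card sCU) (leqnn _)) _.
rewrite mulnC -mul_cardG (leq_ltn_trans (leq_mul leEH (leqnn _))) //.
by rewrite ltn_pmul2l.
Qed.

End Extraspecial2.

(** * Perfect codes of an extraspecial 2-group, case by case *)

Theorem theorem1p2 (gT : finGroupType) (G H : {group gT}) (m : nat)
    (m_gt0 : 0 < m) (pG : 2.-group G) (esG : extraspecial G)
    (oG : #|G| = (2 ^ (2 * m + 1))%N) (sHG : H \subset G) (ntH : H :!=: 1) :
  perfect_code_of G H <->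
  [\/ ~~ abelian H,
      abelian H /\ ~~ (H <| G)
    | [max H | H \subset G & abelian H] /\ G \isog [set: ncprod 'D_8 m]].
Proof.
rewrite addn1 mul2n in oG; have [[_ defG'] prZ] := esG.
have nsZG := center_normal G; have sqZ := square_extraspecial2 pG esG.
rewrite (isog_Dn_p_rank _ _ _ esG oG).
split=> [codeH | [ncHH | [cHH notnsHG] | [maxH rG]]].
- have [cHH|] := boolP (abelian H); last by move=> ncHH; apply: Or31.
  have [nsHG|] := boolP (H <| G); last by move=> notnsHG; apply: Or32.
  have sZH: 'Z(G) \subset H.
    apply: prime_meetG => //; rewrite setIC.
    exact: meet_center_nil (pgroup_nil pG) nsHG ntH.
  apply: Or33; apply: involution_cosets_rank => // x Gx.
  apply: normal_perfect_code_involution nsHG codeH (Gx) _.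
  exact: subsetP sZH _ (sqZ x Gx).
- apply: perfect_code_of_involutions => // x Gx.
  exact: nonabelian_involution_coset Gx.
- apply: perfect_code_of_complement_squares nsZG _ sqZ => //.
  (* The centre is the derived subgroup, so a subgroup containing it is normal. *)
  rewrite setIC prime_TIg //; apply: contra notnsHG => sZH.
  by rewrite sub_der1_normal // defG'.
apply: perfect_code_of_involutions => // x Gx.
exact: rank_involution_cosets oG maxH rG Gx.
Qed.
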